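(* Let $\mathbf n=(\mathbf n(c),c\ge0)$ be degree statistics and write $n=|\mathbf n|_1+1$. Let $(T,V)$ be a uniformly random element of $\mathcal T_{\mathbf n}^{\bullet}$, and let $D=(D_1,\ldots,D_n)$ be a size-biasing of $\mathbf n$. Let $U_1,\ldots,U_n$ be independent Uniform$[0,1]$ random variables, independent of $D$. For $i\in\{1,\ldots,n\}$ let $$A_i=\begin{cases}1&\text{if } U_i\le \dfrac{1+\sum_{j=1}^{i-1}(D_j-1)}{n+1-i},\\ 0&\text{otherwise.}\end{cases}$$ Finally, let $M=\min(i:A_i=1)$. Then $|V|$ and $M-1$ have the same distribution.
   Context: A plane tree is a finite rooted tree in which the children of each node are ordered from left to right. The degree of a node is its number of children. A sequence $\mathbf n=(\mathbf n(c),c\ge0)$ of non-negative integers is called degree statistics if there is a plane tree having, for each $c$, exactly $\mathbf n(c)$ nodes with $c$ children; equivalently $\sum_{c}\mathbf n(c)=1+\sum_c c\,\mathbf n(c)$ (finite). $\mathcal T_{\mathbf n}$ is the set of such plane trees and $\mathcal T_{\mathbf n}^{\bullet}=\{(t,v):t\in\mathcal T_{\mathbf n},\ v\text{ a node of }t\}$. The height $|v|$ of a node is its graph distance to the root. $|\mathbf n|_1=\sum_c c\,\mathbf n(c)$, so $n=\sum_c\mathbf n(c)$ is the number of nodes. A random vector $D=(D_1,\ldots,D_n)$ is a size-biasing of $\mathbf n$ if $n=\sum_c\mathbf n(c)$ and for every sequence $(d_1,\ldots,d_n)$ with $|\{i:d_i=c\}|=\mathbf n(c)$ for all $c$, and every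 $1\le k\le n$, $$\mathbf P\{D_k=d_k\mid (D_1,\ldots,D_{k-1})=(d_1,\ldots,d_{k-1})\}=\frac{d_k\big(\mathbf n(d_k)-w((d_1,\ldots,d_{k-1}),d_k)\big)}{|\mathbf n|_1-d_1-\cdots-d_{k-1}},$$ where $w((d_1,\ldots,d_{k-1}),d)=|\{i\le k-1:d_i=d\}|$, and where the fraction is interpreted as $1$ if $d_1+\cdots+d_{k-1}=|\mathbf n|_1$. *)

(* Defs.v *)
From HB Require Import structures.
From mathcomp Require Import all_boot all_order all_algebra finmap.
From mathcomp Require Import all_classical all_reals all_analysis.

Set Implicit Arguments.
Unset Strict Implicit.
Unset Printing Implicit Defensive.

Import Order.TTheory GRing.Theory Num.Theory.
Import numFieldNormedType.Exports.

Local Open Scope classical_set_scope.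
Local Open Scope card_scope.
Local Open Scope ring_scope.

(** * Plane trees *)

Inductive ptree : Type := PNode of seq ptree.

Definition subtrees (t : ptree) : seq ptree := let: PNode s := t in s.

(* Countability of [ptree], through the library's generic trees. *)
Fixpoint ptree_enc (t : ptree) : GenTree.tree unit :=
  let: PNode s := t in GenTree.Node 0 (map ptree_enc s).

Fixpoint ptree_dec (g : GenTree.tree unit) : ptree :=
  if g is GenTree.Node _ s then PNode (map ptree_dec s) else PNode [::].

Lemma ptree_encK : cancel ptree_enc ptree_dec.
Proof.
rewrite /cancel; fix IH 1 => -[s] /=; congr PNode.
by elim: s => //= t s ->; rewrite IH.
Qed.

HB.instance Definition _ := Countable.copy ptree (can_type ptree_encK).
HB.instance Definition _ := isPointed.Build ptree (PNode [::]).

(* Nodes are addressed by words (Ulam-Harris): [::] is the root and [rcons v i]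
   is the child number i, counting from 0, of the node v. *)
Fixpoint subtree (t : ptree) (v : seq nat) : option ptree :=
  if v is i :: v' then obind (fun s => subtree s v') (onth (subtrees t) i)
  else Some t.

Definition is_node (t : ptree) (v : seq nat) : bool := isSome (subtree t v).

(* 0 when v is not a node of t *)
Definition degree (t : ptree) (v : seq nat) : nat :=
  oapp (fun s => size (subtrees s)) 0%N (subtree t v).

Definition node_children (t : ptree) (v : seq nat) : seq (seq nat) :=
  mkseq (rcons v) (degree t v).

Definition tree_adj (t : ptree) : rel (seq nat) :=
  fun u v => (v \in node_children t u) || (u \in node_children t v).

Definition walk_length (T : eqType) (e : rel T) (x y : T) : set nat :=
  [set k | exists p : seq T, [/\ path e x p, last x p = y & size p = k]].

(* The default value of [get] is used only when no walk joins x to y. *)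
Definition graph_dist (T : eqType) (e : rel T) (x y : T) : nat :=
  get [set k | walk_length e x y k /\
               forall l, walk_length e x y l -> (k <= l)%N].

Definition height (t : ptree) (v : seq nat) : nat :=
  graph_dist (tree_adj t) [::] v.

(** * Degree statistics *)

Definition trees (nn : nat -> nat) : set ptree :=
  [set t | forall c, [set v | is_node t v /\ degree t v = c] #= `I_(nn c)].

Definition degree_statistics (nn : nat -> nat) : Prop := trees nn !=set0.

Definition norm1_seq (nn : nat -> nat) : nat :=
  \big[addn/0%N]_(c \in [set: nat]) (c * nn c)%N.

Definition num_nodes (nn : nat -> nat) : nat :=
  \big[addn/0%N]_(c \in [set: nat]) nn c.

(* Pairs (tree, address), with the discrete sigma-algebra. *)
Definition marked_tree : Type := (ptree * seq nat)%type.

HB.instance Definition _ := Countable.copy marked_tree (ptree * seq nat)%type.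
HB.instance Definition _ := isPointed.Build marked_tree (PNode [::], [::]).
HB.instance Definition _ := @isMeasurable.Build default_measure_display
  marked_tree discrete_measurable discrete_measurable0
  discrete_measurableC discrete_measurableU.

Definition marked_trees (nn : nat -> nat) : set marked_tree :=
  [set x | trees nn x.1 /\ is_node x.1 x.2].

(** * Probability *)

(* If F were infinite or empty the right-hand side would be 0 for B = setT, so
   that no X could satisfy this. *)
Definition uniform_on d d' (Om : measurableType d) (S : measurableType d')
    (R : realType) (P : probability Om R) (X : {RV P >-> S}) (F : set S) :
    Prop :=
  forall B : set S, measurable B ->
    distribution P X B = (#|` fset_set (F `&` B)|%:R / #|` fset_set F|%:R)%:E.

Arguments uniform_on {d d' Om S R} P X F.

Definition cond_prob d (Om : measurableType d) (R : realType)
    (P : probability Om R) (A B : set Om) : R :=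
  fine (P (A `&` B)) / fine (P B).

Definition mutually_independent d d' (Om : measurableType d)
    (S : measurableType d') (R : realType) (P : probability Om R) (n : nat)
    (X : 'I_n -> Om -> S) : Prop :=
  forall (J : {set 'I_n}) (B : 'I_n -> set S),
    (forall i, i \in J -> measurable (B i)) ->
    P (\bigcap_(i in [set i | i \in J]) (X i @^-1` B i)) =
      (\prod_(i in J) P (X i @^-1` B i))%E.

Definition independent_vectors d d1 d2 (Om : measurableType d)
    (S1 : measurableType d1) (S2 : measurableType d2) (R : realType)
    (P : probability Om R) (m n : nat)
    (X : 'I_m -> Om -> S1) (Y : 'I_n -> Om -> S2) : Prop :=
  forall E F : set Om, g_sigma_preimage X E -> g_sigma_preimage Y F ->
    P (E `&` F) = (P E * P F)%E.

(** * Size-biasing and the variable M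

    Vectors are indexed by 'I_n, from 0 to n - 1: the entry that is usually
    numbered i is the one at the ordinal of value i - 1. *)

Definition size_bias_ratio (R : realType) (nn : nat -> nat) (n : nat)
    (d : 'I_n -> nat) (k : 'I_n) : R :=
  let s := (\sum_(j < n | (j < k)%N) d j)%N in
  let w := #|[set j : 'I_n | (j < k)%N && (d j == d k)]%SET| in
  if s == norm1_seq nn then 1
  else (d k)%:R * ((nn (d k))%:R - w%:R) / ((norm1_seq nn)%:R - s%:R).

(* The conditional probability is prescribed only when the event on which one
   conditions has positive probability. *)
Definition size_biasing d (Om : measurableType d) (R : realType)
    (P : probability Om R) (nn : nat -> nat) (n : nat)
    (D : 'I_n -> {RV P >-> nat}) : Prop :=
  n = num_nodes nn /\
  forall d : 'I_n -> nat,
    (forall c, #|[set i : 'I_n | d i == c]%SET| = nn c) ->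
    forall k : 'I_n,
      let past := [set w | forall j : 'I_n, (j < k)%N -> D j w = d j] in
      P past != 0%E ->
      cond_prob P [set w | D k w = d k] past = size_bias_ratio R nn d k.

Arguments size_biasing {d Om R} P nn {n} D.

Definition indicA (R : realType) (Om : Type) (n : nat)
    (D : 'I_n -> Om -> nat) (U : 'I_n -> Om -> R) (i : 'I_n) (w : Om) : nat :=
  if U i w <= (1 + \sum_(j < n | (j < i)%N) ((D j w)%:R - 1)) /
              (n%:R + 1 - i.+1%:R)
  then 1%N else 0%N.

(* The minimum is over the usual numbering 1, ..., n.  The value n + 1 stands
   for the minimum of the empty set, which occurs with probability 0. *)
Definition firstM (R : realType) (Om : Type) (n : nat)
    (D : 'I_n -> Om -> nat) (U : 'I_n -> Om -> R) (w : Om) : nat :=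
  \big[minn/n.+1]_(i < n | indicA D U i w == 1%N) i.+1.

(* Main.v *)
Require Import Defs.
From mathcomp Require Import all_boot all_order all_algebra finmap zify ring.
From mathcomp Require Import all_classical all_reals all_analysis.
From mathcomp Require Import measurable_realfun.

Import Order.TTheory GRing.Theory Num.Theory.
Import numFieldNormedType.Exports.

Local Open Scope classical_set_scope.
Local Open Scope ring_scope.

Set Implicit Arguments.
Unset Strict Implicit.
Unset Printing Implicit Defensive.

(** Both tails are computed exactly.  Let [s] list the n degrees prescribed by
    the statistics, let m(s) be the product of the factorials of its
    multiplicities, and let e_k(s) be the sum, over ordered choices of k
    distinct entries of [s], of the product of these entries.  The two
    distributions agree because

      P(|V| >= k) = e_k(s) (n - k)! / n! = P(M > k)     for every k <= n,

    and both probabilities vanish for k > n.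

    Trees.  A pair (t, v) with |v| >= k is described by the degrees d_1, ..., d_k
    of the first k ancestors of v (from the root down), the child chosen at each
    of them, and what is left when these ancestors are deleted: a forest with a
    node marked in one given tree.  Deleting one ancestor at a time gives a
    recursion for the number of spines, that is of forests with a node of height
    at least k marked in a given tree, hence [size_marked]: there are
    e_k(s) (n - k)! / m(s) of them.  The case k = 0 says that marked forests are
    as many as the words with letters [s]; it combines the recursion with the
    number r (n - 1)! / m(s) of unmarked forests of r trees ([size_forests]),
    which follows from a similar recursion, deleting the root of the first tree.
    The number of trees cancels from the formula for marked forests, which is
    what makes e_k(s) appear.

    Size-biasing.  Given D, the events A_i = 0 are independent, and by
    sum_j (D_j - 1) = -1 the i-th has probability
    (sum_(j >= i) D_j) / (n + 1 - i).  Its numerator is the denominator of the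
    size-biased choice of D_i, so the two cancel and the probability of M > k
    together with D_1 = d_1, ..., D_k = d_k is the product over i <= k of
    d_i times the number of unused entries equal to d_i, over n + 1 - i.  Summing
    over the possible d gives e_k(s) (n - k)! / n! ([sum_prefix_weight_survival],
    [prob_survives]). *)

(** * Multisets of degrees *)

Section Multisets.
Local Open Scope nat_scope.
Implicit Types (s : seq nat) (d k : nat).

(** The product of the factorials of the multiplicities of [s], so that
    (size s)! / multfact s is the number of words with letters [s].  The
    recursion counts each entry together with its later copies, which makes the
    deletion of one entry an easy induction. *)
Fixpoint multfact s : nat :=
  if s is d :: s' then (count_mem d s').+1 * multfact s' else 1.

Lemma multfact_gt0 s : 0 < multfact s.
Proof. by elim: s => //= d s IH; rewrite muln_gt0. Qed.

(** Every recursion below removes one entry from the multiset; this is how the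
    normalization [multfact] changes. *)
Lemma multfact_rem s d :
  d \in s -> multfact s = count_mem d s * multfact (rem d s).
Proof.
elim: s => //= x s IH; rewrite inE (eq_sym x d).
have [->|neq_dx] /= := eqVneq d x; first by rewrite add1n.
by move=> d_s; rewrite {1}IH // count_mem_rem (negPf neq_dx) subn0 add0n mulnCA.
Qed.

Lemma sum_undup s (f : nat -> nat) :
  \sum_(d <- undup s) count_mem d s * f d = \sum_(d <- s) f d.
Proof.
rewrite -[RHS]big_undup_iterop_count; apply: eq_bigr => d _.
by elim: (count_mem d s) => // -[|c] IH; rewrite ?mul1n //= mulSn IH.
Qed.

Lemma sumn_rem s d : d \in s -> sumn s = d + sumn (rem d s).
Proof. by move=> /perm_to_rem/perm_sumn ->. Qed.

(** k! times the k-th elementary symmetric polynomial of the entries of [s]. *)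
Fixpoint ordered_esym k s : nat :=
  if k is k'.+1 then \sum_(d <- s) d * ordered_esym k' (rem d s) else 1.

Lemma ordered_esym_eq0 k s : size s < k -> ordered_esym k s = 0.
Proof.
elim: k s => //= k IH s lt_sk; rewrite big_seq big1 // => d d_s.
rewrite IH ?muln0 // size_rem //; case: s d_s lt_sk => //.
Qed.

End Multisets.

(** * Degrees, addresses and heights in a plane tree *)

Section PlaneTrees.
Local Open Scope nat_scope.
Implicit Types (t : ptree) (f l : seq ptree) (v : seq nat).

(** The induction principle generated for [ptree] says nothing about the trees
    inside the list of children. *)
Lemma ptree_ind_mem (P : ptree -> Prop) :
  (forall l, {in l, forall t, P t} -> P (PNode l)) -> forall t, P t.
Proof.
move=> IH; fix rec 1 => -[l]; apply: IH.
elim: l => [|t l IHl] u; first by clear rec.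
by rewrite inE => /predU1P[->|/IHl]; [apply: rec|apply].
Qed.

Definition leaf := PNode [::].

(** Listed in preorder; only the multiset of degrees matters below. *)
Fixpoint tree_degrees t : seq nat :=
  let: PNode l := t in size l :: flatten (map tree_degrees l).

Definition forest_degrees f : seq nat := flatten (map tree_degrees f).

Lemma tree_degreesE l :
  tree_degrees (PNode l) = size l :: forest_degrees l.
Proof. by []. Qed.

Lemma forest_degrees_cons t f :
  forest_degrees (t :: f) = tree_degrees t ++ forest_degrees f.
Proof. by []. Qed.

Lemma forest_degrees_cat f l :
  forest_degrees (f ++ l) = forest_degrees f ++ forest_degrees l.
Proof. by rewrite /forest_degrees map_cat flatten_cat. Qed.

(** Every node but the root is the child of exactly one node. *)
Lemma sumn_tree_degrees t : (sumn (tree_degrees t)).+1 = size (tree_degrees t).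
Proof.
elim/ptree_ind_mem: t => l IH; rewrite tree_degreesE /=; congr _.+1.
elim: l IH => [//|t l IHl] IH.
rewrite forest_degrees_cons sumn_cat size_cat -IH ?mem_head //= -IHl.
  by rewrite !addSn addnCA.
by move=> u u_l; apply: IH; rewrite inE u_l orbT.
Qed.

Lemma is_node_root t : is_node t [::]. Proof. by []. Qed.

Lemma subtree_cons l i v : i < size l ->
  subtree (PNode l) (i :: v) = subtree (nth leaf l i) v.
Proof.
by move=> lt_i; rewrite /= onthE (nth_map leaf).
Qed.

Lemma is_node_cons l i v :
  is_node (PNode l) (i :: v) = (i < size l) && is_node (nth leaf l i) v.
Proof.
rewrite /is_node; case: ltnP => [lt_i|le_i]; first by rewrite subtree_cons.
by rewrite /= onth_default.
Qed.

Fixpoint addresses t : seq (seq nat) :=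
  let: PNode l := t in
  let ns := map addresses l in
  [::] :: [seq i :: v | i <- iota 0 (size l), v <- nth [::] ns i].

Lemma mem_addresses t v : (v \in addresses t) = is_node t v.
Proof.
elim: v t => [|i v IH] [l]; first by rewrite /= mem_head.
rewrite is_node_cons /= inE /=; apply/allpairsPdep/andP.
  move=> [j [u [j_l u_l [ij vu]]]]; move: j_l u_l; rewrite -{}ij -{}vu.
  rewrite mem_iota add0n /= => lt_i.
  by rewrite (nth_map leaf) // IH.
move=> [lt_i vi]; exists i, v; rewrite mem_iota add0n /= lt_i.
by rewrite (nth_map leaf) // IH.
Qed.

Lemma addresses_uniq t : uniq (addresses t).
Proof.
elim/ptree_ind_mem: t => l IH /=; apply/andP; split.
  by apply/negP => /allpairsPdep[j [u []]].
apply: allpairs_uniq_dep; first exact: iota_uniq.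
  move=> i; rewrite mem_iota add0n /= => lt_i.
  by rewrite (nth_map leaf) //; apply: IH; exact: mem_nth.
by move=> [i v] [j w] _ _ /= [-> ->].
Qed.

Lemma degree_cons l i v : i < size l ->
  degree (PNode l) (i :: v) = degree (nth leaf l i) v.
Proof. by move=> lt_i; rewrite /degree subtree_cons. Qed.

Lemma map_degree_addresses t : map (degree t) (addresses t) = tree_degrees t.
Proof.
elim/ptree_ind_mem: t => l IH /=; congr (_ :: _).
rewrite map_flatten -map_comp; congr flatten.
rewrite -[in RHS](mkseq_nth leaf l) -map_comp; apply/eq_in_map => i.
rewrite mem_iota add0n /= => lt_i.
rewrite (nth_map leaf) // -IH ?mem_nth // -map_comp.
by apply: eq_map => v; rewrite /comp degree_cons.
Qed.

Lemma card_degree t c m :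
  ([set v | is_node t v /\ degree t v = c] #= `I_m)%card <->
  count_mem c (tree_degrees t) = m.
Proof.
pose A := [seq v <- addresses t | degree t v == c].
have uA : uniq A by rewrite filter_uniq // addresses_uniq.
have -> : [set v | is_node t v /\ degree t v = c]
        = [set` [fset v in A]%fset].
  apply/seteqP; split=> v /=; rewrite inE mem_filter mem_addresses.
    by move=> [-> /eqP ->].
  by move=> /andP[/eqP ? ?].
have -> : count_mem c (tree_degrees t) = #|` [fset v in A]%fset|.
  rewrite card_fseq undup_id // size_filter -map_degree_addresses count_map.
  by apply: eq_count.
by split=> [/card_eq_fsetP|<-]; [|apply/card_eq_fsetP].
Qed.

Lemma treesE nn t :
  trees nn t <-> forall c, count_mem c (tree_degrees t) = nn c.
Proof. by split=> H c; have := H c; rewrite card_degree. Qed.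

Lemma trees_perm nn t u :
  trees nn t -> trees nn u <-> perm_eq (tree_degrees u) (tree_degrees t).
Proof.
rewrite !treesE => nnE; split=> [nnE'|/permP eq_c c]; last by rewrite eq_c.
by apply/allP => x _ /=; rewrite nnE nnE'.
Qed.

(** A walk changes the length of the address by at most one at each step; with
    the walk through the prefixes of the address, this identifies the graph
    distance to the root. *)
Lemma tree_adj_size t u v : tree_adj t u v -> size v <= (size u).+1.
Proof.
case/orP=> /mapP[i _ ->]; rewrite size_rcons //.
by rewrite -addn2 leq_addr.
Qed.

Lemma walk_size t u p : path (tree_adj t) u p ->
  size (last u p) <= size u + size p.
Proof.
elim: p u => [|v p IH] u /=; first by rewrite addn0.
case/andP=> /tree_adj_size le_vu /IH; rewrite addnS -addSn => /leq_trans.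
by apply; rewrite leq_add2r.
Qed.

Lemma is_node_rcons t v i :
  is_node t (rcons v i) = is_node t v && (i < degree t v).
Proof.
elim: v t => [|j v IH] [l].
  by rewrite /degree /= is_node_cons andbT.
rewrite rcons_cons !is_node_cons; case: ltnP => //= lt_j.
by rewrite IH degree_cons.
Qed.

Lemma walk_to_node t v : is_node t v ->
  exists p, [/\ path (tree_adj t) [::] p, last [::] p = v & size p = size v].
Proof.
elim/last_ind: v => [|v i IH]; first by exists [::].
rewrite is_node_rcons => /andP[/IH[p [pp lp sp]] lt_i].
exists (rcons p (rcons v i)); rewrite rcons_path last_rcons !size_rcons pp lp sp.
split=> //; apply/orP; left; apply/mapP; exists i => //.
by rewrite mem_iota.
Qed.

Lemma height_node t v : is_node t v -> height t v = size v.
Proof.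
move=> /walk_to_node[p [pp lp sp]]; apply: get_unique.
  split; first by exists p.
  by move=> l [q [/walk_size + <- <-]].
move=> k [[q [/walk_size + lq <-]]]; rewrite lq add0n => le_q min_q.
by apply/eqP; rewrite eqn_leq le_q andbT; apply: min_q; exists p.
Qed.

End PlaneTrees.

(** * Counting forests and marked forests *)

Section Enumeration.
Local Open Scope nat_scope.
Implicit Types (t : ptree) (f l : seq ptree) (v s : seq nat).

(** The inverse of deleting the root of the first tree of a forest: its [d]
    children become the first [d] trees. *)
Definition plant d f := PNode (take d f) :: drop d f.

(** The forests of [r] trees whose degrees are a permutation of [s], where [m]
    is meant to be [size s]. *)
Fixpoint forests m r s : seq (seq ptree) :=
  match m, r with
  | 0, 0 => [:: [::]]
  | m'.+1, r'.+1 =>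
      [seq plant d f | d <- undup s, f <- forests m' (d + r') (rem d s)]
  | _, _ => [::]
  end.

Lemma mem_forests m r s f : size s = m ->
  (f \in forests m r s) = (size f == r) && perm_eq (forest_degrees f) s.
Proof.
elim: m r s f => [|m IH] [|r] s f size_s.
- by rewrite (size0nil size_s) /= inE; case: f => //= -[l] f.
- rewrite (size0nil size_s) /= in_nil; apply/esym/negbTE/negP.
  by move=> /andP[+ /perm_size]; case: f => [|[]].
- rewrite /= in_nil; case: f => //=.
  by apply/esym/negbTE/negP => /perm_size; rewrite size_s.
apply/allpairsPdep/andP.
  move=> [d [g [+ + ->]]]; rewrite mem_undup => d_s.
  rewrite IH ?size_rem ?size_s // => /andP[/eqP size_g perm_g].
  split; first by rewrite /= size_drop size_g addKn.
  rewrite forest_degrees_cons tree_degreesE size_takel ?size_g ?leq_addr //.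
  rewrite cat_cons -forest_degrees_cat cat_take_drop.
  by rewrite perm_sym (perm_trans (perm_to_rem d_s)) // perm_cons perm_sym.
case: f => [|[l] f] [] //= /eqP[size_f].
rewrite forest_degrees_cons tree_degreesE cat_cons => perm_f.
have l_s : size l \in s by rewrite -(perm_mem perm_f) mem_head.
exists (size l), (l ++ f); rewrite mem_undup; split=> //.
  rewrite IH ?size_rem ?size_s // size_cat size_f eqxx /=.
  rewrite -(perm_cons (size l)) forest_degrees_cat.
  by rewrite (perm_trans perm_f) // perm_to_rem.
by rewrite /plant take_size_cat // drop_size_cat.
Qed.

Lemma plant_inj d e f g : d <= size f -> e <= size g ->
  plant d f = plant e g -> d = e /\ f = g.
Proof.
move=> le_d le_e [eq_take eq_drop].
have de : d = e by rewrite -(size_takel le_d) eq_take size_takel.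
by split=> //; rewrite -(cat_take_drop d f) eq_take eq_drop cat_take_drop.
Qed.

Lemma forests_uniq m r s : size s = m -> uniq (forests m r s).
Proof.
elim: m r s => [|m IH] [|r] s size_s //.
apply: allpairs_uniq_dep; first exact: undup_uniq.
  by move=> d; rewrite mem_undup => d_s; rewrite IH ?size_rem ?size_s.
move=> [d f] [e g] /allpairsPdep[d' [f' [d_s f_in [? ?]]]]; subst d' f'.
move=> /allpairsPdep[e' [g' [e_s g_in [? ?]]]] /= eq_plant; subst e' g'.
move: d_s f_in e_s g_in; rewrite !mem_undup => d_s + e_s.
rewrite !mem_forests ?size_rem ?size_s // => /andP[/eqP sf _] /andP[/eqP sg _].
by have [|| -> ->] := plant_inj _ _ eq_plant; rewrite ?sf ?sg ?leq_addr.
Qed.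

(** With m + 1 nodes there are r m! / multfact s forests.  Deleting the first root
    leaves (d + r - 1) (m - 1)! / multfact (rem d s) of them by induction, and the
    sum over the entries [d] of [s] is
    (sumn s + (r - 1) (m + 1)) (m - 1)!, in which sumn s = m + 1 - r. *)
Lemma size_forests m r s : size s = m.+1 -> sumn s + r = size s ->
  size (forests m.+1 r s) * multfact s = r * m`!.
Proof.
elim: m r s => [|m IH] [|r] s size_s sum_s; rewrite ?mul0n //.
  case: s size_s sum_s => [|d [|]] //= _; rewrite addn0 addnS => -[].
  by case: d r => [|d] [|r].
rewrite [forests _ _ _]/= -/(forests m.+1) size_allpairs_dep sumnE big_map.
rewrite big_distrl /=.
under eq_big_seq => d.
  rewrite mem_undup => d_s; rewrite (multfact_rem d_s) mulnCA IH; first over.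
    by rewrite size_rem ?size_s.
  by rewrite size_rem // addnA [_ + d]addnC -(sumn_rem d_s) -sum_s addnS.
(* Each value of [d] is now weighted by its multiplicity. *)
rewrite sum_undup -big_distrl /= big_split /= -sumnE.
rewrite big_const_seq count_predT iter_addn_0 factS mulnA; congr (_ * _).
by apply: (@addnI r.+1); rewrite size_s; move: sum_s; rewrite size_s; nia.
Qed.

(** A forest whose first tree carries a marked node: the first tree, the address
    of the mark, and the other trees. *)
Definition spine := (ptree * seq nat * seq ptree)%type.

(** Plants under a new root of degree [d] the marked tree, as child number
    [i], and the first [d - 1] other trees, as the other children in order. *)
Definition graft (di : nat * nat) (y : spine) : spine :=
  let: (d, i) := di in let: (t, v, l) := y in
  (PNode (take i l ++ t :: drop i (take d.-1 l)), i :: v, drop d.-1 l).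

(** The unmarked trees that remain after the deletion of the root of [t], when the
    mark lies in its child number [i]. *)
Definition ungraft_trees (t : ptree) (i : nat) (l : seq ptree) : seq ptree :=
  take i (subtrees t) ++ drop i.+1 (subtrees t) ++ l.

Definition child_slots s := [seq (d, i) | d <- undup s, i <- iota 0 d].

Definition root_marks f : spine := (head leaf f, [::], behead f).

(** The spines with degrees [s], [q] unmarked trees and a mark of height at least
    [k], where [m] is meant to be [size s].  The mark is either the root of its
    tree, which is possible for k = 0 only, or lies below the root. *)
Fixpoint marked m k q s : seq spine :=
  if m is m'.+1 then
    (if k is 0 then map root_marks (forests m'.+1 q.+1 s) else [::]) ++
    [seq graft di y | di <- child_slots s,
                      y <- marked m' k.-1 (q + di.1.-1) (rem di.1 s)]
  else [::].

Lemma markedS m k q s :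
  marked m.+1 k q s =
    (if k is 0 then map root_marks (forests m.+1 q.+1 s) else [::]) ++
    [seq graft di y | di <- child_slots s,
                      y <- marked m k.-1 (q + di.1.-1) (rem di.1 s)].
Proof. by []. Qed.

Lemma mem_child_slots s d i :
  ((d, i) \in child_slots s) = (d \in s) && (i < d).
Proof.
apply/allpairsPdep/andP => [[e [j []]]|[d_s lt_i]].
  by rewrite mem_undup mem_iota add0n /= => ? ? [-> ->].
by exists d, i; rewrite mem_undup mem_iota.
Qed.

Lemma mem_marked m k q s t v l : size s = m ->
  ((t, v, l) \in marked m k q s) =
  [&& size l == q, perm_eq (tree_degrees t ++ forest_degrees l) s,
      is_node t v & k <= size v].
Proof.
elim: m k q s t v l => [|m IH] k q s t v l size_s.
  rewrite (size0nil size_s) in_nil; apply/esym/negbTE/negP.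
  by case: t => ch /and4P[_ /perm_size].
rewrite markedS mem_cat; case: v => [|i v].
  have -> : ((t, [::], l) \in [seq graft di y | di <- child_slots s,
             y <- marked m k.-1 (q + di.1.-1) (rem di.1 s)]) = false.
    by apply/negP => /allpairsPdep[[d i] [[[u w] l'] [_ _]]].
  rewrite orbF is_node_root; case: k => [|k]; last by rewrite !andbF.
  rewrite !andbT; apply/mapP/andP => [[f]|[/eqP size_l perm_l]].
    rewrite mem_forests // => /andP[size_f perm_f].
    by case: f size_f perm_f => // u f /= size_f perm_f [-> ->].
  by exists (t :: l); rewrite // mem_forests //= size_l eqxx.
have -> : ((t, i :: v, l) \in (if k is 0 then map root_marks
            (forests m.+1 q.+1 s) else [::])) = false.
  by case: k => // ; apply/negP => /mapP[f _ []].
rewrite orFb; apply/allpairsPdep/and4P.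
  move=> [[d j] [[[u w] l'] [d_s + [-> ij -> ->]]]]; subst j.
  move: d_s; rewrite mem_child_slots => /andP[d_s lt_i].
  rewrite IH ?size_rem ?size_s //=.
  move=> /and4P[/eqP size_l' perm_l' u_w le_k].
  have le_d : d.-1 <= size l' by rewrite size_l' leq_addl.
  have le_i : i <= d.-1 by lia.
  have size_i : size (take i l') = i by rewrite size_takel // (leq_trans le_i).
  have -> : take i l' = take i (take d.-1 l') by rewrite take_takel.
  have size_i' : size (take i (take d.-1 l')) = i by rewrite take_takel.
  split.
  - by rewrite size_drop size_l' addnK.
  - rewrite perm_sym (perm_trans (perm_to_rem d_s)) // perm_sym.
    rewrite size_cat /= size_i' size_drop size_takel // addnS subnKC //.
    rewrite prednK ?(leq_ltn_trans _ lt_i) // perm_cons.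
    rewrite -(permPr perm_l') -forest_degrees_cat.
    rewrite -[_ ++ forest_degrees l']/(forest_degrees (u :: l')).
    apply: perm_flatten; apply: perm_map.
    rewrite -[in X in perm_eq _ X](cat_take_drop d.-1 l') -cat_cons perm_cat2r.
    by rewrite perm_catC /= perm_cons perm_catC cat_take_drop.
  - rewrite is_node_cons size_cat size_i' /= -addSnnS leq_addr /=.
    by rewrite nth_cat size_i' ltnn subnn.
  - by case: k le_k.
case: t => ch [/eqP size_l perm_l + le_k]; rewrite is_node_cons.
move=> /andP[lt_i ch_v]; set d := size ch.
have d_s : d \in s by rewrite -(perm_mem perm_l) tree_degreesE mem_head.
pose l' := ungraft_trees (PNode ch) i l.
have d_gt0 : 0 < d by exact: leq_ltn_trans lt_i.
have size_i : size (take i ch) = i by rewrite size_takel // ltnW.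
have size_ch : size (take i ch ++ drop i.+1 ch) = d.-1.
  by rewrite size_cat size_i size_drop; move: lt_i; rewrite -/d; lia.
have take_l' : take d.-1 l' = take i ch ++ drop i.+1 ch.
  by rewrite /l' /ungraft_trees catA -size_ch take_size_cat.
have drop_l' : drop d.-1 l' = l.
  by rewrite /l' /ungraft_trees catA -size_ch drop_size_cat.
exists (d, i), (nth leaf ch i, v, l'); split.
- by rewrite mem_child_slots d_s.
- rewrite IH ?size_rem ?size_s //=; apply/and4P; split=> //.
  + by rewrite /l' /ungraft_trees catA size_cat size_ch size_l addnC.
  + rewrite -(perm_cons d) -(permPr (perm_to_rem d_s)) -(permPr perm_l).
    rewrite tree_degreesE /= perm_cons -forest_degrees_cat.
    rewrite -[_ ++ forest_degrees l']/(forest_degrees (nth leaf ch i :: l')).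
    apply: perm_flatten; apply: perm_map.
    rewrite /l' /ungraft_trees /= -[in X in perm_eq _ X](cat_take_drop i ch).
    rewrite (drop_nth leaf lt_i) -catA perm_sym; apply/permEl.
    exact: (perm_catCA (take i ch) [:: nth leaf ch i] (drop i.+1 ch ++ l)).
  + by case: k le_k.
rewrite /= drop_l' take_l' drop_size_cat //.
rewrite {1}/l' /ungraft_trees /= take_size_cat //.
by rewrite -drop_nth // cat_take_drop.
Qed.

Lemma graft_inj d i e j y z : i < d -> j < e ->
  d.-1 <= size y.2 -> e.-1 <= size z.2 ->
  graft (d, i) y = graft (e, j) z -> (d, i) = (e, j) /\ y = z.
Proof.
case: y z => [[t v] l] [[u w] l'] /= lt_i lt_j le_d le_e [+ ij vw].
subst j w; rewrite (_ : take i l = take i (take d.-1 l)); last first.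
  by rewrite take_takel //; lia.
rewrite (_ : take i l' = take i (take e.-1 l')); last first.
  by rewrite take_takel //; lia.
set a := take d.-1 l; set b := take e.-1 l' => eq_ch eq_drop.
have size_a : size a = d.-1 by rewrite size_takel.
have size_b : size b = e.-1 by rewrite size_takel.
have le_ia : i <= size a by lia.
have le_ib : i <= size b by lia.
have size_ab : size (take i a) = size (take i b).
  by rewrite (size_takel le_ia) (size_takel le_ib).
move/eqP: eq_ch; rewrite eqseq_cat // => /andP[/eqP eq_t].
rewrite eqseq_cons => /andP[/eqP tu /eqP eq_d].
have ab : a = b by rewrite -(cat_take_drop i a) eq_t eq_d cat_take_drop.
have de : d = e by move: size_a; rewrite ab size_b; lia.
split; first by rewrite de.
by rewrite tu -(cat_take_drop d.-1 l) eq_drop -/a ab cat_take_drop.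
Qed.

Lemma marked_uniq m k q s : size s = m -> uniq (marked m k q s).
Proof.
elim: m k q s => [|m IH] k q s size_s //.
rewrite markedS cat_uniq; apply/and3P; split.
- case: k => // ; rewrite map_inj_in_uniq ?forests_uniq // => f g.
  rewrite !mem_forests //; case: f => [|t f] //; case: g => [|u g] // _ _.
  by move=> [-> ->].
- apply/hasPn => y /allpairsPdep[[d i] [[[u w] l] [_ _ ->]]].
  by case: k => // ; apply/negP => /mapP[f _ []].
apply: allpairs_uniq_dep.
- apply: allpairs_uniq_dep; first exact: undup_uniq.
    by move=> d _; exact: iota_uniq.
  by move=> [d i] [e j] _ _ /= [-> ->].
- move=> [d i]; rewrite mem_child_slots => /andP[d_s _].
  by rewrite IH ?size_rem ?size_s.
move=> [[d i] y] [[e j] z] /allpairsPdep[[d' i'] [y' [d_s y_in [? ? ?]]]].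
subst d' i' y'.
move=> /allpairsPdep[[e' j'] [z' [e_s z_in [? ? ?]]]] /= eq_graft; subst e' j' z'.
move: d_s e_s y_in z_in; rewrite !mem_child_slots.
case: y z eq_graft => [[t v] l] [[u w] l'] eq_graft.
move=> /andP[d_s lt_i] /andP[e_s lt_j].
rewrite !mem_marked ?size_rem ?size_s //=.
move=> /and4P[/eqP sl _ _ _] /and4P[/eqP sl' _ _ _].
have [||[-> ->] ->] // :=
  @graft_inj d i e j (t, v, l) (u, w, l') lt_i lt_j _ _ eq_graft.
  by rewrite sl leq_addl.
by rewrite sl' leq_addl.
Qed.

(** The number of trees does not enter the count.  For k > 0, the recursion on
    the degree of the root is the one that defines [ordered_esym].  For k = 0 and m + 1
    nodes, up to the division by [multfact s], the forests marked at a root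
    contribute (q + 1) m! and the others (sumn s) m!, hence (m + 1)! in total. *)
Lemma size_marked m k q s : size s = m -> sumn s + q.+1 = m ->
  size (marked m k q s) * multfact s = ordered_esym k s * (m - k)`!.
Proof.
elim: m k q s => [|m IH] k q s size_s sum_s; first by rewrite addnS in sum_s.
have step k' : size [seq graft di y | di <- child_slots s,
      y <- marked m k' (q + di.1.-1) (rem di.1 s)] * multfact s =
    ordered_esym k'.+1 s * (m - k')`!.
  rewrite size_allpairs_dep sumnE big_map /child_slots big_allpairs_dep.
  rewrite [ordered_esym k'.+1 s]/= big_distrl -(sum_undup s) big_distrl /=.
  apply: eq_big_seq => d; rewrite mem_undup => d_s.
  rewrite big_const_seq count_predT size_iota iter_addn_0.
  case: (posnP d) => [->|d_gt0]; first by rewrite muln0 !mul0n muln0 mul0n.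
  rewrite (multfact_rem d_s) (mulnC _ d) mulnACA IH.
  - by rewrite !mulnA (mulnC d).
  - by rewrite size_rem ?size_s.
  - by move: sum_s; rewrite (sumn_rem d_s); lia.
rewrite markedS size_cat mulnDl; case: k => [|k]; last first.
  by rewrite mul0n add0n subSS; exact: step.
rewrite size_map (size_forests size_s) ?size_s // step /= mul1n subn0.
under [X in _ + X * _]eq_bigr do rewrite muln1.
by rewrite -sumnE -mulnDl addnC sum_s factS.
Qed.

End Enumeration.

(** * Size-biased prefixes *)

Section SizeBiasAlgebra.
Variable R : realType.
Implicit Types (s x y : seq nat) (d k : nat).

(** The words of length [k] that begin some arrangement of [s], without
    repetition. *)
Fixpoint prefixes k s : seq (seq nat) :=
  if k is k'.+1 then [seq d :: x | d <- undup s, x <- prefixes k' (rem d s)]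
  else [:: [::]].

Lemma prefixesP k s x : x \in prefixes k s ->
  size x = k /\ exists s', perm_eq s (x ++ s').
Proof.
elim: k s x => [|k IH] s x /=.
  by rewrite inE => /eqP ->; split=> //; exists s.
move=> /allpairsPdep[d [y [+ + ->]]]; rewrite mem_undup => d_s.
move=> /IH[<- [s' perm_s']]; split=> //; exists s'.
by rewrite (perm_trans (perm_to_rem d_s)) //= perm_cons.
Qed.

Lemma prefixes_uniq k s : uniq (prefixes k s).
Proof.
elim: k s => [//|k IH] s; apply: allpairs_uniq_dep; first exact: undup_uniq.
  by move=> d _; exact: IH.
by move=> [d x] [e y] _ _ /= [-> ->].
Qed.

(** The probability that the next degree is [d], by size-biased sampling, when [s]
    lists the degrees not used so far. *)
Definition bias s d : R :=
  if sumn s == 0%N then 1 else d%:R * (count_mem d s)%:R / (sumn s)%:R.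

Fixpoint prefix_weight x s : R :=
  if x is d :: x' then bias s d * prefix_weight x' (rem d s) else 1.

(** The probability that A_1 = ... = A_k = 0 when D begins with [x]. *)
Definition survival k x s : R :=
  \prod_(i < k) (((sumn s)%:R - (sumn (take i x))%:R) / ((size s)%:R - i%:R)).

Lemma survivalS k d x s : d \in s ->
  survival k.+1 (d :: x) s =
  (sumn s)%:R / (size s)%:R * survival k x (rem d s).
Proof.
move=> d_s; rewrite /survival big_ord_recl /= !subr0; congr (_ * _).
apply: eq_bigr => i _; rewrite /bump leq0n /= add1n.
rewrite (sumn_rem d_s) (perm_size (perm_to_rem d_s)) /=.
rewrite !natrD opprD addrACA subrr add0r.
by rewrite -!natr1 opprD addrACA subrr addr0.
Qed.

Lemma sum_bias s : s != [::] -> \sum_(d <- undup s) bias s d = 1.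
Proof.
move=> s_neq0; rewrite /bias; have [sum0|sum_neq0] := eqVneq (sumn s) 0%N.
  have s0 d : d \in s -> d = 0%N.
    by move=> /sumn_rem; rewrite sum0; case: d.
  have undup_s : perm_eq (undup s) [:: 0%N]; last first.
    by rewrite (perm_big _ undup_s) big_seq1.
  apply: uniq_perm => [||d] //; first exact: undup_uniq.
  rewrite mem_undup inE; apply/idP/eqP => [/s0 //|->].
  case: s s_neq0 s0 {sum0} => // e s _.
  by move=> /(_ e (mem_head e s)) <-; exact: mem_head.
have sum_s : \sum_(d <- undup s) d%:R * (count_mem d s)%:R = (sumn s)%:R :> R.
  rewrite sumnE -(sum_undup s id) natr_sum; apply: eq_bigr => d _.
  by rewrite natrM mulrC.
by rewrite -mulr_suml sum_s divff // pnatr_eq0.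
Qed.

Lemma sum_prefix_weight k s : (k <= size s)%N ->
  \sum_(x <- prefixes k s) prefix_weight x s = 1.
Proof.
elim: k s => [|k IH] s le_k /=; first by rewrite big_seq1.
rewrite big_allpairs_dep -[RHS](sum_bias (s := s)); last by case: s le_k.
apply: eq_big_seq => d; rewrite mem_undup => d_s /=.
rewrite -big_distrr /= IH ?mulr1 // size_rem // -ltnS prednK //.
by case: s le_k d_s.
Qed.

(** The factor [sumn s] of [survival] cancels the denominator of [bias]; what is
    left, summed over the first entry, is the recursion of [ordered_esym]. *)
Lemma sum_prefix_weight_survival k s : (k <= size s)%N ->
  \sum_(x <- prefixes k s) prefix_weight x s * survival k x s =
  (ordered_esym k s * (size s - k)`!)%:R / (size s)`!%:R.
Proof.
elim: k s => [|k IH] s le_k /=.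
  rewrite big_seq1 /survival big_ord0 mulr1 mul1n subn0.
  by rewrite divff // pnatr_eq0 -lt0n fact_gt0.
case size_s : (size s) le_k => [//|m] le_k.
rewrite big_allpairs_dep -(sum_undup s) natrM natr_sum !mulr_suml.
apply: eq_big_seq => d; rewrite mem_undup => d_s.
under eq_bigr => x _ do rewrite /= survivalS // mulrACA.
rewrite -mulr_sumr IH ?size_rem ?size_s //= factS !natrM invfM.
have -> : bias s d * ((sumn s)%:R / m.+1%:R) =
          (count_mem d s)%:R * d%:R / m.+1%:R.
  (* When the sum vanishes, so does [d], and both sides are zero. *)
  rewrite /bias; case: ifPn => [/eqP sum0|sum_neq0].
    have := sumn_rem d_s; rewrite sum0; case: d {d_s} => // _.
    by rewrite mulr0 !mul0r mulr0.
  rewrite mulrA divfK ?pnatr_eq0 //; congr (_ / _); exact: mulrC.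
rewrite !mulrA subSS; ring.
Qed.

End SizeBiasAlgebra.

(** * Probabilistic preliminaries *)

Section Probability.
Variable R : realType.

(** P(X = k) = P(X >= k) - P(X > k), and B is a countable union of points. *)
Lemma pushforward_tails d1 d2 (Om1 : measurableType d1) (Om2 : measurableType d2)
    (P1 : probability Om1 R) (P2 : probability Om2 R)
    (X : Om1 -> nat) (Y : Om2 -> nat) :
  (forall k, measurable [set w | (k <= X w)%N]) ->
  (forall k, measurable [set w | (k <= Y w)%N]) ->
  (forall k, P1 [set w | (k <= X w)%N] = P2 [set w | (k <= Y w)%N]) ->
  forall B, pushforward P1 X B = pushforward P2 Y B.
Proof.
have fiber d (Om : measurableType d) (Z : Om -> nat) k :
    Z @^-1` [set k] = [set w | (k <= Z w)%N] `\` [set w | (k < Z w)%N].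
  apply/seteqP; split=> w /=; first by move=> ->; rewrite ltnn.
  move=> [le_k /negP]; rewrite -leqNgt => ge_k.
  by apply/eqP; rewrite eqn_leq ge_k.
have decomp d (Om : measurableType d) (P : probability Om R) (Z : Om -> nat) B :
    (forall k, measurable [set w | (k <= Z w)%N]) ->
    pushforward P Z B = (\sum_(k <oo | k \in B) (P [set w | (k <= Z w)%N] -
                                      P [set w | (k < Z w)%N]))%E.
  move=> mZ; rewrite /pushforward.
  have -> : Z @^-1` B = \bigcup_(k in B) (Z @^-1` [set k]).
    apply/seteqP; split=> w /=; first by move=> Bw; exists (Z w).
    by move=> [k Bk /= ->].
  rewrite measure_bigcup.
  - apply: eq_eseriesr => k _.
    rewrite fiber measureD //; last first.
      exact: le_lt_trans (probability_le1 P (mZ k)) (ltry 1).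
    congr (_ - P _)%E; apply/seteqP; split=> w /=; first by case.
    by move=> lt_k; split=> //; exact: ltnW.
  - by move=> k _; rewrite fiber; apply: measurableD.
  - by move=> i j _ _ [w [/= -> ->]].
move=> mX mY eqP12 B; rewrite !decomp //.
by apply: eq_eseriesr => k _; rewrite !eqP12.
Qed.

Lemma uniform_prob_gt (c : R) : 0 <= c <= 1 ->
  uniform_prob (@ltr01 R) `]c, +oo[ = (1 - c)%:E.
Proof.
move=> /andP[c_ge0 c_le1]; rewrite /uniform_prob integral_uniform_pdf.
have -> : [set` `]c, +oo[] `&` [set` `[0, 1]] = [set` `]c, 1]] :> set R.
  apply/seteqP; split=> x /=; rewrite !in_itv /= ?andbT.
    by move=> [-> /andP[_ ->]].
  by move=> /andP[cx ->]; rewrite cx (le_trans c_ge0 (ltW cx)).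
rewrite (eq_integral (fun=> 1%:E)); last first.
  move=> x; rewrite inE /= in_itv /= => /andP[cx x1]; rewrite /uniform_pdf.
  by rewrite (le_trans c_ge0 (ltW cx)) x1 subr0 invr1.
rewrite integral_cst //= lebesgue_measure_itv /= lte_fin mul1e.
case: ltP => [_ //|le_1c]; have -> : c = 1 by apply/le_anti/andP.
by rewrite subrr.
Qed.

Lemma uniform_on_seq d d' (Om : measurableType d) (S : measurableType d')
    (P : probability Om R) (X : {RV P >-> S}) (F B : set S) (r1 r : seq S) :
  uniform_on P X F -> measurable B -> uniq r -> uniq r1 ->
  F = [set` r] -> F `&` B = [set` r1] ->
  P (X @^-1` B) = ((size r1)%:R / (size r)%:R)%:E.
Proof.
have card_seq (l : seq S) : uniq l -> #|` fset_set [set` l]| = size l.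
  move=> l_uniq; have -> : [set` l] = [set` [fset x in l]%fset].
    by apply/seteqP; split=> x /=; rewrite inE.
  by rewrite set_fsetK card_fseq undup_id.
move=> uX mB r_uniq r1_uniq F_r FB_r1.
by have := uX B mB; rewrite FB_r1 F_r !card_seq.
Qed.

End Probability.

(** * The law of the first entries of a size-biasing *)

Section Events.
Variables (R : realType) (d : measure_display) (Om : measurableType d).
Variable P : probability Om R.

(** Turns sums and cardinals over the indices of a vector that precede a given
    one into sums and counts over the list of its first entries. *)
Lemma big_ord_prefix (T : Type) (idx : T) (op : T -> T -> T) (y z : seq nat)
    (n : nat) (p : pred nat) (F : nat -> T) : size (y ++ z) = n ->
  \big[op/idx]_(j < n | (j < size y)%N && p (nth 0%N (y ++ z) j))
      F (nth 0%N (y ++ z) j) = \big[op/idx]_(c <- y | p c) F c.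
Proof.
move=> size_yz; rewrite -(big_mkord
  (fun j => (j < size y)%N && p (nth 0%N (y ++ z) j))
  (fun j => F (nth 0%N (y ++ z) j))).
under eq_bigl do rewrite andbC.
rewrite -big_nat_widen; last by rewrite -size_yz size_cat leq_addr.
rewrite [RHS](big_nth 0%N) big_nat_cond [RHS]big_nat_cond.
apply: eq_big => [j|j /andP[/andP[_ lt_j] _]]; last by rewrite nth_cat lt_j.
by case: (ltnP j (size y)) => lt_j; rewrite ?andbF //= nth_cat lt_j.
Qed.

Lemma event_g_sigma d' (S : measurableType d') n (X : 'I_n -> Om -> S)
    (J : pred 'I_n) (B : 'I_n -> set S) :
  (forall j, J j -> measurable (B j)) ->
  g_sigma_preimage X [set w | forall j, J j -> B j (X j w)].
Proof.
move=> mB.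
set G := \big[setU/set0]_(i < n) preimage_set_system setT (X i) measurable.
rewrite (_ : [set w | _] = \bigcap_(j in [set j | J j]) (X j @^-1` B j)) //.
apply: (@fin_bigcap_measurable _ (g_sigma_algebraType G)) => [|j Jj].
  exact: finite_finset.
apply: sub_sigma_algebra; rewrite /G (bigD1 j) //=; left.
by exists (B j); [exact: mB|rewrite setTI].
Qed.

Lemma measurable_event d' (S : measurableType d') n (X : 'I_n -> {RV P >-> S})
    (J : pred 'I_n) (B : 'I_n -> set S) :
  (forall j, J j -> measurable (B j)) ->
  measurable [set w | forall j, J j -> B j (X j w)].
Proof.
move=> mB.
rewrite (_ : [set w | _] = \bigcap_(j in [set j | J j]) (X j @^-1` B j)) //.
apply: fin_bigcap_measurable => [|j Jj]; first exact: finite_finset.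
exact/measurable_funPTI/mB.
Qed.

Definition prefix_event n (D : 'I_n -> Om -> nat) (x : seq nat) : set Om :=
  [set w | forall j : 'I_n, (j < size x)%N -> D j w = nth 0%N x j].

Lemma measurable_prefix_event n (D : 'I_n -> {RV P >-> nat}) x :
  measurable (prefix_event (fun i w => D i w) x).
Proof.
exact: (@measurable_event _ _ _ D (fun j => (j < size x)%N)
  (fun j => [set nth 0%N x j])).
Qed.

Lemma prefix_event_rcons n (D : 'I_n -> Om -> nat) x e (k : 'I_n) :
  k = size x :> nat ->
  prefix_event D (rcons x e) = prefix_event D x `&` [set w | D k w = e].
Proof.
move=> kE; apply/seteqP; split=> w /=.
  move=> Dw; split=> [j lt_j|].
    by rewrite Dw ?size_rcons ?nth_rcons ?lt_j // ltnS ltnW.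
  by rewrite Dw ?size_rcons ?kE // nth_rcons ltnn eqxx.
move=> [Dx Dk] j; rewrite size_rcons ltnS leq_eqVlt => /predU1P[jk|lt_j].
  have -> : j = k by exact/val_inj/(etrans jk).
  by rewrite Dk nth_rcons kE ltnn eqxx.
by rewrite Dx // nth_rcons lt_j.
Qed.

Lemma norm1_seq_count nn (s : seq nat) : (forall c, nn c = count_mem c s) ->
  norm1_seq nn = sumn s.
Proof.
move=> nnE; rewrite /norm1_seq (fsbigE (undup s)) ?undup_uniq //; last first.
  by move=> c _; rewrite mem_undup nnE => /count_memPn ->; rewrite muln0.
rewrite sumnE -(sum_undup s id); apply: eq_big => c; first by rewrite in_setT.
by rewrite nnE mulnC.
Qed.

Section SizeBiasing.
Variables (nn : nat -> nat) (n : nat) (D : 'I_n -> {RV P >-> nat}).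
Variable s : seq nat.
Hypothesis nnE : forall c, nn c = count_mem c s.
Hypothesis size_s : size s = n.
Hypothesis hD : size_biasing P nn D.

Local Notation E := (prefix_event (fun i w => D i w)).

(** The conditional probabilities are prescribed along complete degree sequences
    and on events of positive probability only.  So the prefix is completed to
    [y ++ e :: rem e z], an arbitrary arrangement, and when the conditioning event
    is null both sides are zero. *)
Lemma prob_prefix_rcons y z e : perm_eq s (y ++ z) -> e \in z ->
  P (E (rcons y e)) = (P (E y) * (bias R z e)%:E)%E.
Proof.
move=> perm_s e_z; have perm_ez := perm_to_rem e_z.
have perm_s' : perm_eq s (rcons y e ++ rem e z).
  by rewrite cat_rcons (perm_trans perm_s) // perm_cat2l.
set x := rcons y e ++ rem e z in perm_s'.
have size_x : size x = n by rewrite -size_s (perm_size perm_s').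
have x_cat : x = y ++ e :: rem e z by rewrite /x cat_rcons.
have lt_y : (size y < n)%N.
  by rewrite -size_x x_cat size_cat /= addnS ltnS leq_addr.
pose k := Ordinal lt_y.
have xk : nth 0%N x k = e by rewrite x_cat nth_cat ltnn subnn.
have count_x c : #|[set i : 'I_n | nth 0%N x i == c]%SET| = nn c.
  rewrite -sum1_card nnE (permP perm_s') -sum1_count.
  rewrite -(big_ord_prefix _ _ (z := [::]) (n := n)) ?cats0 //.
  by apply: eq_bigl => i; rewrite inE size_x ltn_ord.
rewrite (@prefix_event_rcons _ _ _ _ k) //.
have past_E : E y = [set w | forall j : 'I_n, (j < k)%N -> D j w = nth 0%N x j].
  by apply/seteqP; split=> w /= Dw j lt_j; rewrite Dw // x_cat nth_cat lt_j.
have fin_P A : measurable A -> P A = (fine (P A))%:E.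
  by move=> mA; rewrite fineK // fin_num_measure.
have mE : measurable (E y) by exact: measurable_prefix_event.
have mDk : measurable [set w | D k w = e].
  exact: (@measurable_funPTI _ _ _ _ (D k) [set e]).
have [PE0|PE_neq0] := eqVneq (P (E y)) 0%E.
  rewrite PE0 mul0e; apply: (subset_measure0 _ _ _ PE0) => //.
  exact: measurableI.
have [_ /(_ (fun i => nth 0%N x i) count_x k)] := hD.
rewrite /= -past_E xk setIC => /(_ PE_neq0) cond_E.
rewrite (fin_P (_ `&` _)); last exact: measurableI.
rewrite (fin_P (E y)) // -EFinM; congr EFin.
have fine_neq0 : fine (P (E y)) != 0.
  by apply: contra_neq PE_neq0 => PE0; rewrite fin_P // PE0.
move: cond_E; rewrite /cond_prob => /(canRL (divfK fine_neq0)) ->.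
rewrite mulrC; congr (_ * _); rewrite /size_bias_ratio xk.
rewrite (norm1_seq_count nnE) (perm_sumn perm_s) sumn_cat.
have -> : (\sum_(j < n | (j < k)%N) nth 0 x j)%N = sumn y.
  rewrite sumnE -(big_ord_prefix _ _ (z := e :: rem e z) (n := n)) -?x_cat //.
  by apply: eq_bigl => j; rewrite andbT.
have -> : #|[set j : 'I_n | (j < k)%N && (nth 0%N x j == e)]%SET| = count_mem e y.
  rewrite -sum1_card -sum1_count.
  rewrite -(big_ord_prefix _ _ (z := e :: rem e z) (n := n)) -?x_cat //.
  by apply: eq_bigl => j; rewrite inE.
rewrite nnE (permP perm_s) count_cat /bias.
rewrite -[X in X == _]addn0 eqn_add2l eq_sym !natrD.
by rewrite ![_ + _ - _]addrAC !subrr !add0r.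
Qed.

Lemma prob_prefix_cat k y z x : perm_eq s (y ++ z) -> x \in prefixes k z ->
  P (E (y ++ x)) = (P (E y) * (prefix_weight R x z)%:E)%E.
Proof.
elim: k y z x => [|k IH] y z x perm_s /=.
  by rewrite inE => /eqP ->; rewrite cats0 mule1.
move=> /allpairsPdep[e [x' [+ x'_z ->]]]; rewrite mem_undup => e_z.
rewrite -cat_rcons (IH _ (rem e z)) //; last first.
  by rewrite cat_rcons (perm_trans perm_s) // perm_cat2l perm_to_rem.
by rewrite (prob_prefix_rcons perm_s) //= EFinM muleA.
Qed.

Lemma prob_prefix k x : x \in prefixes k s -> P (E x) = (prefix_weight R x s)%:E.
Proof.
move=> x_s; rewrite -[x]cat0s (prob_prefix_cat (k := k) (z := s)) //.
rewrite (_ : E [::] = setT) ?probability_setT ?mul1e //.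
by apply/seteqP; split.
Qed.

End SizeBiasing.
End Events.

(** * The tail of M *)

Section Survival.
Variables (R : realType) (d : measure_display) (Om : measurableType d).
Variable P : probability Om R.

(** The bound with which U_(i+1) is compared to define A_(i+1), indices starting
    at 0 here, when D begins with [x].  It is written as one minus a factor of
    [survival]; the two forms agree by [indicA_threshold]. *)
Definition threshold (x s : seq nat) (i : nat) : R :=
  1 - ((sumn s)%:R - (sumn (take i x))%:R) / ((size s)%:R - i%:R).

Lemma sumn_take_le (x : seq nat) i : (sumn (take i x) <= sumn x)%N.
Proof. by rewrite -[in leqRHS](cat_take_drop i x) sumn_cat leq_addr. Qed.

(** In a prefix of positive weight, zeros come only after all the positive degrees
    have been used. *)
Lemma prefix_weight_take k x s i : x \in prefixes k s ->
  prefix_weight R x s != 0 -> (i <= k)%N ->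
  sumn (take i x) = sumn s \/ (i <= sumn (take i x))%N.
Proof.
elim: k x s i => [|k IH] x s [|i] //; try by move=> *; right.
move=> /allpairsPdep[e [y [+ y_s ->]]]; rewrite mem_undup => e_s /=.
rewrite mulf_eq0 negb_or ltnS => /andP[bias_neq0 prefix_weight_neq0] le_i.
have [sum_y|le_iy] := IH _ _ _ y_s prefix_weight_neq0 le_i.
  by left; rewrite sum_y -sumn_rem.
move: bias_neq0; rewrite /bias; case: (eqVneq (sumn s) 0%N) => [sum0 _|_].
  left; have := sumn_rem e_s; rewrite sum0.
  have [_ [z /perm_sumn]] := prefixesP y_s; rewrite sumn_cat.
  by have := sumn_take_le y i; lia.
case: (posnP e) => [->|e_gt0 _]; first by rewrite !mul0r eqxx.
by right; rewrite -add1n leq_add.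
Qed.

(** Nonzero weight matters: two leading zeros would make the third threshold
    negative. *)
Lemma threshold_itv k x s i : (sumn s).+1 = size s -> x \in prefixes k s ->
  prefix_weight R x s != 0 -> (i < k)%N -> (k <= size s)%N ->
  0 <= threshold x s i <= 1.
Proof.
move=> sum_s x_s prefix_weight_neq0 lt_i le_k; rewrite /threshold.
have [_ [z /perm_sumn]] := prefixesP x_s; rewrite sumn_cat => sum_x.
have le_take := sumn_take_le x i.
have le_take_s : (sumn (take i x) <= sumn s)%N.
  by rewrite sum_x (leq_trans le_take) ?leq_addr.
have lt_i_s : (i < size s)%N by exact: leq_trans lt_i le_k.
rewrite -!natrB ?(ltnW lt_i_s) // subr_ge0 ler_pdivrMr ?ltr0n ?subn_gt0 //.
rewrite mul1r ler_nat lerBlDr lerDl divr_ge0 ?ler0n // andbT.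
have [->|le_it] := prefix_weight_take x_s prefix_weight_neq0 (ltnW lt_i).
  by rewrite subnn.
by rewrite -sum_s (leq_trans (leq_sub2l _ le_it)) ?leq_sub2r.
Qed.

Lemma prob_uniforms_gt n (U : 'I_n -> {RV P >-> R}) (J : pred 'I_n)
    (c : 'I_n -> R) :
  (forall (i : 'I_n) (B : set R), measurable B ->
     distribution P (U i) B = uniform_prob (@ltr01 R) B) ->
  mutually_independent P (fun i w => U i w) ->
  (forall i, J i -> 0 <= c i <= 1) ->
  P [set w | forall i, J i -> c i < U i w] = (\prod_(i < n | J i) (1 - c i))%:E.
Proof.
move=> hU hUind c01.
have := hUind [set i | J i]%SET
  (fun i => [set` `]c i, +oo[]) (fun i _ => measurable_itv _).
have -> : \bigcap_(i in [set i | i \in [set i | J i]%SET])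
    ((fun w => U i w) @^-1` [set` `]c i, +oo[]) =
    [set w | forall i, J i -> c i < U i w].
  apply/seteqP; split=> w /= Uw i.
    by move=> Ji; have := Uw i; rewrite /= inE in_itv /= andbT; apply.
  by rewrite /= inE in_itv /= andbT => /Uw.
move=> ->; rewrite (big_morph EFin EFinM erefl).
apply: eq_big => i; first by rewrite inE.
rewrite inE => Ji; rewrite -uniform_prob_gt ?c01 // -(hU i) //.
Qed.

Section SizeBiasing.
Variables (nn : nat -> nat) (n : nat) (D : 'I_n -> {RV P >-> nat}).
Variables (U : 'I_n -> {RV P >-> R}) (s : seq nat).
Hypothesis nnE : forall c, nn c = count_mem c s.
Hypothesis size_s : size s = n.
Hypothesis sum_s : (sumn s).+1 = size s.
Hypothesis hD : size_biasing P nn D.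
Hypothesis hU : forall (i : 'I_n) (B : set R), measurable B ->
       distribution P (U i) B = uniform_prob (@ltr01 R) B.
Hypothesis hUind : mutually_independent P (fun i w => U i w).
Hypothesis hUD : independent_vectors P (fun i w => U i w) (fun i w => D i w).

Local Notation E := (prefix_event (fun i w => D i w)).
Local Notation A := (indicA (fun i w => D i w) (fun i w => U i w)).

Definition survives k : set Om :=
  [set w | forall i : 'I_n, (i < k)%N -> A i w <> 1%N].

Lemma indicA_threshold x w (i : 'I_n) : E x w -> (i < size x)%N ->
  (A i w <> 1%N) <-> threshold x s i < U i w.
Proof.
move=> Ex lt_i; rewrite /indicA.
set c := (X in U i w <= X).
suff -> : threshold x s i = c by case: leP.
rewrite /threshold /c.
have sum_D : \sum_(j < n | (j < i)%N) ((D j w)%:R - 1) =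
    (sumn (take i x))%:R - i%:R :> R.
  have size_x : (size (take i x) = i)%N by rewrite size_takel // ltnW.
  rewrite sumnE natr_sum -[in i%:R]size_x -sum1_size natr_sum -sumrB.
  pose x' := take i x ++ take (n - i) (nseq n 0%N).
  have size_x' : size x' = n.
    by rewrite size_cat size_x size_takel ?size_nseq ?leq_subr // subnKC // ltnW.
  rewrite -(big_ord_prefix _ _ predT (fun c => c%:R - 1) size_x') size_x.
  apply: eq_big => [j|j lt_j]; first by rewrite andbT.
  by rewrite Ex ?(ltn_trans lt_j) // nth_cat size_x lt_j nth_take.
have den_neq0 : n%:R - i%:R != 0 :> R by rewrite subr_eq0 eqr_nat gtn_eqF.
have sumE : (sumn s)%:R = n%:R - 1 :> R by rewrite -size_s -sum_s -natr1 addrK.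
have -> : n%:R + 1 - i.+1%:R = n%:R - i%:R :> R by rewrite -natr1; ring.
rewrite sum_D size_s sumE; field; exact: den_neq0.
Qed.

Lemma measurable_survives k : measurable (survives k).
Proof.
rewrite (_ : survives k = \bigcap_(i in [set i : 'I_n | (i < k)%N])
   [set w | (1 + \sum_(j < n | (j < i)%N) ((D j w)%:R - 1)) /
              (n%:R + 1 - i.+1%:R) < U i w]); last first.
  apply/seteqP; split=> w /= Sw i lt_i; have := Sw i lt_i; rewrite /indicA /=.
    by case: leP.
  by case: leP.
apply: fin_bigcap_measurable => [|i _]; first exact: finite_finset.
have mD j : measurable_fun setT (fun w => (D j w)%:R - 1 : R).
  apply: measurable_funB => //.
  by apply: (measurableT_comp (f := fun m : nat => m%:R : R)).
have mltr : measurable_fun setT (fun w => (1 + \sum_(j < n | (j < i)%N)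
    ((D j w)%:R - 1)) / (n%:R + 1 - i.+1%:R) < U i w).
  apply: measurable_fun_ltr => //.
  apply: measurable_funM => //; apply: measurable_funD => //.
  by under eq_fun do rewrite -big_filter; exact: measurable_sum.
by have := mltr measurableT [set true] I; rewrite setTI.
Qed.

(** When D begins with [x], the event that A_1 = ... = A_k = 0 is described by U
    alone, so independence applies. *)
Lemma prob_prefix_survives k x : (k <= n)%N -> x \in prefixes k s ->
  P (survives k `&` E x) = (prefix_weight R x s * survival R k x s)%:E.
Proof.
move=> le_k x_s; have [size_x _] := prefixesP x_s.
pose T := [set w | forall i : 'I_n, (i < k)%N -> threshold x s i < U i w].
have -> : survives k `&` E x = T `&` E x.
  apply/seteqP; split=> w [Sw Ex]; split=> // i lt_i.
    by apply/(indicA_threshold Ex); rewrite ?size_x //; exact: Sw.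
  by apply/(indicA_threshold Ex); rewrite ?size_x //; exact: Sw.
rewrite hUD; first last.
- exact: (@event_g_sigma _ _ _ _ _ (fun i w => D i w)
    (fun j => (j < size x)%N) (fun j => [set nth 0%N x j])).
- have -> : T = [set w | forall i : 'I_n, (i < k)%N ->
      [set` `]threshold x s i, +oo[] (U i w)].
    apply/seteqP; split=> w /= Tw i lt_i;
      by have := Tw i lt_i; rewrite /= in_itv /= andbT.
  exact: (@event_g_sigma _ _ _ _ _ (fun i w => U i w) (fun i => (i < k)%N)
    (fun i => [set` `]threshold x s i, +oo[])).
rewrite (prob_prefix nnE size_s hD x_s).
have [->|prefix_weight_neq0] := eqVneq (prefix_weight R x s) 0.
  by rewrite mule0 mul0r.
rewrite prob_uniforms_gt //; last first.
  by move=> i lt_i; apply: (threshold_itv sum_s x_s) => //; rewrite size_s.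
rewrite -EFinM mulrC; congr (_ * _)%:E; rewrite /survival.
rewrite (big_ord_widen_cond n predT (fun i => ((sumn s)%:R -
  (sumn (take i x))%:R) / ((size s)%:R - i%:R))) //.
by apply: eq_bigr => i _; rewrite /threshold opprB addrC subrK.
Qed.

(** The possible prefixes have total probability one, so it suffices to sum
    [prob_prefix_survives] over them. *)
Lemma prob_survives k : (k <= n)%N ->
  P (survives k) = ((ordered_esym k s * (n - k)`!)%:R / n`!%:R)%:E.
Proof.
move=> le_k; pose V := \bigcup_(x in [set` prefixes k s]) E x.
have mE x : measurable (E x) by exact: measurable_prefix_event.
have mS := measurable_survives k.
have fin_V : finite_set [set` prefixes k s] by exact: finite_seq.
have triv_E : trivIset [set` prefixes k s] (fun x => E x).
  move=> x y /= /prefixesP[size_x _] /prefixesP[size_y _] [w [Ex Ey]].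
  apply: (@eq_from_nth _ 0%N) => [|j lt_j]; first by rewrite size_x.
  have lt_jn : (j < n)%N by rewrite (leq_trans lt_j) ?size_x.
  by rewrite -(Ex (Ordinal lt_jn)) // (Ey (Ordinal lt_jn)) //= size_y -size_x.
have mV : measurable V by apply: fin_bigcup_measurable.
have PV : P V = 1%E.
  rewrite measure_fin_bigcup // -fsbig_seq ?prefixes_uniq //.
  rewrite -(sum_prefix_weight R (k := k) (s := s)) ?size_s // -sumEFin.
  by apply: eq_big_seq => x /(prob_prefix nnE size_s hD).
have -> : P (survives k) = P (survives k `&` V).
  rewrite (measureDI P mS mV) [X in (X + _)%E](_ : _ = 0%E) ?add0e //.
  apply: (@subset_measure0 _ _ _ P _ (~` V)).
  - exact: measurableD.
  - exact: measurableC.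
  - by move=> w [].
  - by apply: etrans (probability_setC P mV) _; rewrite PV subee.
rewrite /V setI_bigcupr measure_fin_bigcup //; last 2 first.
- by move=> x y x_s y_s [w [[_ Ex] [_ Ey]]]; apply: triv_E => //; exists w.
- by move=> x _; exact: measurableI.
rewrite -fsbig_seq ?prefixes_uniq //.
have := @sum_prefix_weight_survival R k s; rewrite size_s => <- //.
rewrite -sumEFin; apply: eq_big_seq => x x_s; exact: prob_prefix_survives.
Qed.

(** Since M >= 1, subtracting one in the natural numbers loses nothing, and the
    value n + 1 of the empty minimum is large enough because k <= n. *)
Lemma firstM_ge k w : (k <= n)%N ->
  (k <= firstM (fun i w' => D i w') (fun i w' => U i w') w - 1)%N <->
  survives k w.
Proof.
move=> le_k.
have minE m : (m <= n.+1)%N ->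
    (m <= firstM (fun i w' => D i w') (fun i w' => U i w') w)%N =
    [forall (i : 'I_n | A i w == 1%N), m <= i.+1]%N.
  move=> le_m; rewrite /firstM (big_morph (leq m) (id1 := true) (op1 := andb)).
  - by rewrite big_andE.
  - by move=> a b; rewrite leq_min.
  - by rewrite le_m.
have M_gt0 : (0 < firstM (fun i w' => D i w') (fun i w' => U i w') w)%N.
  by rewrite minE //; apply/forallP => i; apply/implyP.
rewrite leq_subRL // add1n minE ?ltnS //; split.
  move=> /forallP Mk i lt_i /eqP Ai; have := Mk i; rewrite Ai /= ltnS.
  by rewrite leqNgt lt_i.
move=> Sw; apply/forallP => i; apply/implyP => /eqP Ai.
by rewrite ltnS leqNgt; apply/negP => /Sw.
Qed.

Lemma firstM_le w :
  (firstM (fun i w' => D i w') (fun i w' => U i w') w - 1 <= n)%N.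
Proof.
rewrite leq_subLR add1n /firstM; apply: (big_ind (fun m => m <= n.+1)%N) => //.
- by move=> a b le_a _; rewrite geq_min le_a.
- by move=> i _; rewrite ltnS ltnW.
Qed.

End SizeBiasing.
End Survival.

(** * The tail of the height, and the conclusion *)

Section HeightTail.
Variables (R : realType) (nn : nat -> nat) (t0 : ptree).
Hypothesis t0_nn : trees nn t0.

Let s := tree_degrees t0.
(** The marked trees whose mark has height at least [k]. *)
Let deep k := [seq y.1 | y <- marked (size s) k 0 s].

Lemma mem_deep k t v :
  ((t, v) \in deep k) =
  [&& perm_eq (tree_degrees t) s, is_node t v & (k <= size v)%N].
Proof.
apply/mapP/idP => [[[[u w] l] + [-> ->]]|t_v].
  by rewrite mem_marked //; case: l => //=; rewrite cats0.
by exists (t, v, [::]); rewrite // mem_marked //= cats0.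
Qed.

Lemma deep_uniq k : uniq (deep k).
Proof.
rewrite map_inj_in_uniq ?marked_uniq // => -[[t v] l] [[u w] l'].
rewrite !mem_marked // => /andP[/nilP -> _] /andP[/nilP -> _] /=.
by move=> [-> ->].
Qed.

Lemma prob_height_ge d (Om : measurableType d) (P : probability Om R)
    (TV : {RV P >-> marked_tree}) (k : nat) : uniform_on P TV (marked_trees nn) ->
  P [set w | (k <= height (TV w).1 (TV w).2)%N] =
  ((ordered_esym k s * (size s - k)`!)%:R / (size s)`!%:R)%:E.
Proof.
move=> uTV; pose B := [set x : marked_tree | (k <= height x.1 x.2)%N].
have marked_deep : marked_trees nn = [set` deep 0].
  apply/seteqP; split=> -[t v] /=.
    by move=> [/(trees_perm _ t0_nn) /= ts tv]; rewrite mem_deep ts tv.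
  rewrite mem_deep andbT => /andP[ts tv]; split=> //=.
  exact/(trees_perm _ t0_nn).
have deep_B : marked_trees nn `&` B = [set` deep k].
  rewrite marked_deep; apply/seteqP; split=> -[t v] /=; rewrite !mem_deep.
    by move=> [/and3P[-> tv _]]; rewrite /B /= height_node // tv.
  by move=> /and3P[-> tv le_k]; rewrite /B /= height_node // tv.
have -> := uniform_on_seq uTV (B := B) I (deep_uniq 0) (deep_uniq k)
  marked_deep deep_B.
congr EFin; rewrite !size_map.
have multfact_neq0 : (multfact s)%:R != 0 :> R.
  by rewrite pnatr_eq0 -lt0n multfact_gt0.
have size_s : (sumn s + 1 = size s)%N by rewrite addn1 sumn_tree_degrees.
rewrite -(@size_marked (size s) k 0 s) // natrM.
have -> : (size s)`! = (size (marked (size s) 0 0 s) * multfact s)%N.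
  by rewrite size_marked // mul1n subn0.
by rewrite natrM -mulf_div divff ?mulr1.
Qed.

End HeightTail.

Theorem proposition2p1 (R : realType) (nn : nat -> nat)
    (hnn : degree_statistics nn) (n : nat) (hn : n = (norm1_seq nn + 1)%N)
    (d1 : measure_display) (Om1 : measurableType d1) (P1 : probability Om1 R)
    (TV : {RV P1 >-> marked_tree}) (hTV : uniform_on P1 TV (marked_trees nn))
    (d2 : measure_display) (Om2 : measurableType d2) (P2 : probability Om2 R)
    (D : 'I_n -> {RV P2 >-> nat}) (hD : size_biasing P2 nn D)
    (U : 'I_n -> {RV P2 >-> R})
    (hU : forall (i : 'I_n) (B : set R), measurable B ->
       distribution P2 (U i) B = uniform_prob (@ltr01 R) B)
    (hUind : mutually_independent P2 (fun i w => U i w))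
    (hUD : independent_vectors P2 (fun i w => U i w) (fun i w => D i w)) :
  forall B : set nat,
    pushforward P1 (fun w => height (TV w).1 (TV w).2) B =
    pushforward P2 (fun w =>
      (firstM (fun i w' => D i w') (fun i w' => U i w') w - 1)%N) B.
Proof.
have [t0 t0_nn] := hnn; pose s := tree_degrees t0.
have nnE c : nn c = count_mem c s by move/treesE: t0_nn.
have sum_s : (sumn s).+1 = size s by exact: sumn_tree_degrees.
have size_s : size s = n by rewrite hn (norm1_seq_count nnE) addn1.
have firstM_tail k : (k <= n)%N ->
    [set w | (k <= firstM (fun i w' => D i w') (fun i w' => U i w') w - 1)%N] =
    survives D U k.
  by move=> le_k; apply/seteqP; split=> w /firstM_ge; apply.
have firstM_tail0 k : (n < k)%N ->
    [set w | (k <= firstM (fun i w' => D i w') (fun i w' => U i w') w - 1)%N] =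
    set0.
  move=> lt_k; apply/seteqP; split=> w //= /(leq_trans lt_k).
  by rewrite ltnNge firstM_le.
apply: pushforward_tails => k.
- exact: (@measurable_funPTI _ _ _ _ TV [set x | (k <= height x.1 x.2)%N]).
- have [/firstM_tail ->|/firstM_tail0 -> //] := leqP k n.
  exact: measurable_survives.
- rewrite (prob_height_ge t0_nn) // -/s; have [le_k|lt_k] := leqP k n.
    rewrite firstM_tail // size_s.
    exact/esym/(prob_survives nnE size_s sum_s hD hU hUind hUD le_k).
  by rewrite firstM_tail0 // measure0 ordered_esym_eq0 ?size_s // mul0n mul0r.
Qed.
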